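(* Let $X$ and $Y$ be (real) normed spaces, $n\ge1$, $\vec x\in X\otimes\mathbb R^n$ and $\vec y\in Y\otimes\mathbb R^n$. Then $$C^{-1}\big|[\vec x]_X[\vec y]_Y\big|\le\langle\!\langle\vec x\rangle\!\rangle_X\cdot\langle\!\langle\vec y\rangle\!\rangle_Y=\|\vec x\odot\vec y\|_{X\otimes_\varepsilon Y}\le\|\vec x\odot\vec y\|_{X\otimes_\pi Y}\le C\,\big|[\vec x]_X[\vec y]_Y\big|,$$ where the constant $C\ge1$ depends only on $n$.
   Context: Elements of $X\otimes\mathbb R^n$ are identified with $\vec x=(x_1,\dots,x_n)\in X^n$. For $x^*\in X^*$ (normed dual, with closed unit ball $\bar B_{X^*}$) and $\vec e\in\mathbb R^n$, put $\langle\vec x,x^*\rangle=(\langle x_i,x^*\rangle)_{i=1}^n\in\mathbb R^n$ and $\vec x\cdot\vec e=\sum_{i=1}^n e_ix_i\in X$. Convex bodies: $\langle\!\langle\vec x\rangle\!\rangle_X:=\{\langle\vec x,x^*\rangle:x^*\in\bar B_{X^*}\}\subseteq\mathbb R^n$, and similarly for $Y$. The Minkowski dot product $\{\vec a\cdot\vec b:\vec a\in\langle\!\langle\vec x\rangle\!\rangle_X,\ \vec b\in\langle\!\langle\vec y\rangle\!\rangle_Y\}$ is a symmetric interval $[-c,c]\subseteq\mathbb R$, and $\langle\!\langle\vec x\rangle\!\rangle_X\cdot\langle\!\langle\vec y\rangle\!\rangle_Y$ denotes its right end-point $c$. Tensors: $\vec x\odot\vec y:=\sum_{i=1}^nx_i\otimes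 y_i\in X\otimes Y$ (algebraic tensor product). For $\omega=\sum_i f_i\otimes g_i\in X\otimes Y$, the injective norm is $\|\omega\|_{X\otimes_\varepsilon Y}=\sup\{\sum_i\langle f_i,x^*\rangle\langle g_i,y^*\rangle:x^*\in\bar B_{X^*},y^*\in\bar B_{Y^*}\}$, and the projective norm is $\|\omega\|_{X\otimes_\pi Y}=\inf\{\sum_{i=1}^k\|u_i\|_X\|v_i\|_Y:\omega=\sum_{i=1}^ku_i\otimes v_i,\ u_i\in X,\ v_i\in Y,\ k\in\mathbb N\}$. Reducing matrices: $[\vec x]_X$ denotes any positive semi-definite $n\times n$ matrix with $c^{-1}|[\vec x]_X\vec e|\le\|\vec x\cdot\vec e\|_X\le c\,|[\vec x]_X\vec e|$ for all $\vec e\in\mathbb R^n$, where $c=c(n)\ge1$ is a fixed constant depending only on $n$ for which such a matrix always exists; similarly $[\vec y]_Y$. The matrix is not unique; the statement holds for any choice. $|\cdot|$ is the Euclidean norm of vectors and the corresponding operator norm of matrices. *)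

(* Defs.v *)
From HB Require Import structures.
From mathcomp Require Import all_boot all_order all_algebra.
From mathcomp Require Import all_classical all_reals all_analysis.

Set Implicit Arguments.
Unset Strict Implicit.
Unset Printing Implicit Defensive.

Import Order.TTheory GRing.Theory Num.Theory.
Import numFieldNormedType.Exports.

Local Open Scope classical_set_scope.
Local Open Scope ring_scope.
Local Open Scope quotient_scope.

(* The algebraic tensor product of two modules over a commutative ring: formal
   sums of pairs, modulo the congruence generated by the bilinear relations.
   No formal negatives or scalars are needed, since a *: (u ⊗ v) = (a *: u) ⊗ v. *)

Inductive tensor_rel (R : comNzRingType) (U V : lmodType R) :
    seq (U * V) -> seq (U * V) -> Prop :=
| tensor_rel_refl s : tensor_rel s s
| tensor_rel_sym s t : tensor_rel s t -> tensor_rel t s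
| tensor_rel_trans s t r : tensor_rel s t -> tensor_rel t r -> tensor_rel s r
| tensor_rel_cat s s' t t' :
    tensor_rel s s' -> tensor_rel t t' -> tensor_rel (s ++ t) (s' ++ t')
| tensor_rel_catC s t : tensor_rel (s ++ t) (t ++ s)
| tensor_rel_0l v : tensor_rel [:: (0, v)] [::]
| tensor_rel_Dl u u' v : tensor_rel [:: (u + u', v)] [:: (u, v); (u', v)]
| tensor_rel_Dr u v v' : tensor_rel [:: (u, v + v')] [:: (u, v); (u, v')]
| tensor_rel_Z a u v : tensor_rel [:: (a *: u, v)] [:: (u, a *: v)].

Section Tensor.
Context {R : comNzRingType} {U V : lmodType R}.
Implicit Types (s t : seq (U * V)) (u : U) (v : V) (a b : R).

Definition tensor_eqv : rel (seq (U * V)) := fun s t => `[< tensor_rel s t >].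

Fact tensor_eqv_refl : reflexive tensor_eqv.
Proof. by move=> s; apply/asboolP; exact: tensor_rel_refl. Qed.

Fact tensor_eqv_sym : symmetric tensor_eqv.
Proof.
by move=> s t; apply/idP/idP => /asboolP h; apply/asboolP;
  exact: tensor_rel_sym.
Qed.

Fact tensor_eqv_trans : transitive tensor_eqv.
Proof.
by move=> s t r /asboolP h /asboolP h'; apply/asboolP;
  exact: tensor_rel_trans h h'.
Qed.

Canonical tensor_equiv :=
  EquivRel tensor_eqv tensor_eqv_refl tensor_eqv_sym tensor_eqv_trans.

Definition tensor := {eq_quot tensor_equiv}.

HB.instance Definition _ := Choice.on tensor.
HB.instance Definition _ := EqQuotient.on tensor.

Lemma pi_tensorP s t :
  tensor_rel s t <-> \pi_tensor s = \pi_tensor t :> tensor.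
Proof.
split=> [h|/eqP]; first by apply/eqP; rewrite eqmodE; apply/asboolP.
by rewrite eqmodE => /asboolP.
Qed.

Let tensorW (w : tensor) : exists s, w = \pi_tensor s.
Proof. by exists (repr w); rewrite reprK. Qed.

Lemma repr_tensor s : tensor_rel (repr (\pi_tensor s : tensor)) s.
Proof. by apply/pi_tensorP; rewrite reprK. Qed.

Definition tensor_zero : tensor := \pi_tensor [::].
Definition tensor_add (w z : tensor) : tensor := \pi_tensor (repr w ++ repr z).
Definition tensor_scale a (w : tensor) : tensor :=
  \pi_tensor [seq (a *: p.1, p.2) | p <- repr w].
Definition tensor_opp (w : tensor) : tensor := tensor_scale (-1) w.

Let scs a s := [seq (a *: p.1, p.2) | p <- s].

Let scs_rel a s t : tensor_rel s t -> tensor_rel (scs a s) (scs a t).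
Proof.
rewrite /scs; elim=> {s t} /= [s|s t _ h|s t r _ h _ h'|s s' t t' _ h _ h'
  |s t|v|u u' v|u v v'|b u v].
- exact: tensor_rel_refl.
- exact: tensor_rel_sym.
- exact: tensor_rel_trans h h'.
- by rewrite !map_cat; exact: tensor_rel_cat.
- by rewrite !map_cat; exact: tensor_rel_catC.
- by rewrite scaler0; exact: tensor_rel_0l.
- by rewrite scalerDr; exact: tensor_rel_Dl.
- exact: tensor_rel_Dr.
- by rewrite scalerA mulrC -scalerA; exact: tensor_rel_Z.
Qed.

Let addE s t :
  tensor_add (\pi_tensor s) (\pi_tensor t) = \pi_tensor (s ++ t).
Proof. by apply/pi_tensorP/tensor_rel_cat; exact: repr_tensor. Qed.

Let scaleE a s : tensor_scale a (\pi_tensor s) = \pi_tensor (scs a s).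
Proof. by apply/pi_tensorP/scs_rel; exact: repr_tensor. Qed.

Fact tensor_addA : associative tensor_add.
Proof.
by move=> w z y; have [s ->] := tensorW w; have [t ->] := tensorW z; have [r ->] := tensorW y;
  rewrite !addE catA.
Qed.

Fact tensor_addC : commutative tensor_add.
Proof.
move=> w z; have [s ->] := tensorW w; have [t ->] := tensorW z; rewrite !addE.
by apply/pi_tensorP; exact: tensor_rel_catC.
Qed.

Fact tensor_add0 : left_id tensor_zero tensor_add.
Proof. by move=> w; have [s ->] := tensorW w; rewrite addE. Qed.

Fact tensor_scaleDl w a b :
  tensor_scale (a + b) w = tensor_add (tensor_scale a w) (tensor_scale b w).
Proof.
have [s ->] := tensorW w; rewrite !scaleE addE; apply/pi_tensorP; rewrite /scs.
elim: s => [|[u v] s ih] /=; first exact: tensor_rel_refl.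
rewrite scalerDl.
apply: tensor_rel_trans.
  exact: (tensor_rel_cat (tensor_rel_Dl (a *: u) (b *: u) v) ih).
apply: (tensor_rel_cat (s := [:: (a *: u, v)]) (s' := [:: (a *: u, v)])).
  exact: tensor_rel_refl.
rewrite -cat1s catA -[in X in tensor_rel _ X]cat1s [X in tensor_rel _ X]catA.
by apply: tensor_rel_cat; [exact: tensor_rel_catC|exact: tensor_rel_refl].
Qed.

Fact tensor_scale0 w : tensor_scale 0 w = tensor_zero.
Proof.
have [s ->] := tensorW w; rewrite scaleE; apply/pi_tensorP; rewrite /scs.
elim: s => [|[u v] s ih] /=; first exact: tensor_rel_refl.
rewrite scale0r.
apply: (tensor_rel_cat (s := [:: (0, v)]) (s' := [::])) ih.
exact: tensor_rel_0l.
Qed.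

Fact tensor_scale1 : left_id 1 tensor_scale.
Proof.
move=> w; have [s ->] := tensorW w; rewrite scaleE /scs; congr \pi; rewrite -[RHS]map_id.
by apply: eq_map => -[u v] /=; rewrite scale1r.
Qed.

Fact tensor_addN : left_inverse tensor_zero tensor_opp tensor_add.
Proof.
move=> w; rewrite -[X in tensor_add _ X]tensor_scale1 -tensor_scaleDl addNr.
exact: tensor_scale0.
Qed.

HB.instance Definition _ := GRing.isZmodule.Build tensor
  tensor_addA tensor_addC tensor_add0 tensor_addN.

Fact tensor_scaleA a b w :
  tensor_scale a (tensor_scale b w) = tensor_scale (a * b) w.
Proof.
have [s ->] := tensorW w; rewrite !scaleE /scs -map_comp; congr \pi.
by apply: eq_map => -[u v] /=; rewrite scalerA.
Qed.

Fact tensor_scaleDr : right_distributive tensor_scale +%R.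
Proof.
move=> a w z; have [s ->] := tensorW w; have [t ->] := tensorW z.
by rewrite -[_ + _]/(tensor_add _ _) addE !scaleE
  -[RHS]/(tensor_add _ _) addE /scs map_cat.
Qed.

HB.instance Definition _ := GRing.Zmodule_isLmodule.Build R tensor
  tensor_scaleA tensor_scale1 tensor_scaleDr
  (fun w a b => tensor_scaleDl w a b).

Definition tens u v : tensor := \pi_tensor [:: (u, v)].

Lemma tensDl u u' v : tens (u + u') v = tens u v + tens u' v.
Proof.
by rewrite -[RHS]/(tensor_add _ _) addE; apply/pi_tensorP/tensor_rel_Dl.
Qed.

Lemma tensDr u v v' : tens u (v + v') = tens u v + tens u v'.
Proof.
by rewrite -[RHS]/(tensor_add _ _) addE; apply/pi_tensorP/tensor_rel_Dr.
Qed.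

Lemma tensZl a u v : tens (a *: u) v = a *: tens u v.
Proof. by rewrite -[RHS]/(tensor_scale _ _) scaleE. Qed.

Lemma tensZr a u v : tens u (a *: v) = a *: tens u v.
Proof. by rewrite -tensZl; apply/pi_tensorP/tensor_rel_sym/tensor_rel_Z. Qed.

Lemma pi_tensorE s : \pi_tensor s = \sum_(p <- s) tens p.1 p.2 :> tensor.
Proof.
elim: s => [|[u v] s ih]; first by rewrite big_nil.
by rewrite big_cons -ih -[RHS]/(tensor_add _ _) addE.
Qed.

Lemma tensorP (w : tensor) : exists s, w = \sum_(p <- s) tens p.1 p.2.
Proof. by exists (repr w); rewrite -pi_tensorE reprK. Qed.

(* The linear map induced by a bilinear map B, i.e. the universal property of
   the tensor product. The value is meaningful only for bilinear B, for which it
   does not depend on the representative, see tensor_lift_sum. *)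
Definition tensor_lift (Z : lmodType R) (B : U -> V -> Z) (w : tensor) : Z :=
  \sum_(p <- repr w) B p.1 p.2.

Section Lift.
Context {Z : lmodType R} {B : U -> V -> Z}.
Hypothesis Bl : forall v, linear (B^~ v).
Hypothesis Br : forall u, linear (B u).

Lemma tensor_lift_sum s :
  tensor_lift B (\sum_(p <- s) tens p.1 p.2) = \sum_(p <- s) B p.1 p.2.
Proof.
rewrite -pi_tensorE /tensor_lift.
move: (repr _) (repr_tensor s) => t.
elim=> {s t} /= [s|s t _ h|s t r _ h _ h'|s s' t t' _ h _ h'|s t|v|u u' v|u v v'|a u v] //.
- by rewrite h h'.
- by rewrite !big_cat /= h h'.
- by rewrite !big_cat /= addrC.
- rewrite big_seq1 big_nil /=.
  by have := Bl v (-1) 0 0; rewrite scaler0 addr0 scaleN1r addNr.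
- rewrite !big_cons !big_nil /= !addr0.
  by have := Bl v 1 u u'; rewrite !scale1r.
- rewrite !big_cons !big_nil /= !addr0.
  by have := Br u 1 v v'; rewrite !scale1r.
- rewrite !big_seq1 /=.
  have B0u : B 0 v = 0.
    by have := Bl v (-1) 0 0; rewrite scaler0 addr0 scaleN1r addNr.
  have B0v : B u 0 = 0.
    by have := Br u (-1) 0 0; rewrite scaler0 addr0 scaleN1r addNr.
  have := Bl v a u 0; rewrite addr0 B0u addr0 => ->.
  by have := Br u a v 0; rewrite addr0 B0v addr0 => ->.
Qed.

Lemma tensor_lift_tens u v : tensor_lift B (tens u v) = B u v.
Proof. by have := tensor_lift_sum [:: (u, v)]; rewrite !big_seq1. Qed.

End Lift.

End Tensor.

Arguments tensor {R} U V.

Section Norms.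
Context {R : realType}.

Definition dual_norm {X : normedModType R} (f : {linear X -> R^o}) : R :=
  sup [set `|f x| | x in [set x : X | `|x| <= 1]].

(* [dual_norm] is only meaningful for bounded functionals, since the [sup] of an
   unbounded set is 0: continuity has to be required separately. *)
Definition dual_ball (X : normedModType R) : set {linear X -> R^o} :=
  [set f : {linear X -> R^o} | continuous f /\ dual_norm f <= 1].
Arguments dual_ball X _ : clear implicits.

Definition injective_norm {X Y : normedModType R} (w : tensor X Y) : R :=
  sup [set tensor_lift (fun u v => f u * g v : R^o) w
      | f in dual_ball X & g in dual_ball Y].

Definition projective_norm {X Y : normedModType R} (w : tensor X Y) : R :=
  inf [set \sum_(p <- s) `|p.1| * `|p.2|
      | s in [set s : seq (X * Y) | w = \sum_(p <- s) tens p.1 p.2]].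

Context {n : nat}.

Definition eucl_norm (e : 'cV[R]_n) : R := Num.sqrt (\sum_i e i 0 ^+ 2).

Definition op_norm (A : 'M[R]_n) : R :=
  sup [set eucl_norm (A *m e) | e in [set e | eucl_norm e <= 1]].

Definition positive_semidefinite (A : 'M[R]_n) : Prop :=
  A^T = A /\ forall e : 'cV[R]_n, 0 <= (e^T *m A *m e) 0 0.

Definition vdot {X : normedModType R} (x : 'I_n -> X) (e : 'cV[R]_n) : X :=
  \sum_i e i 0 *: x i.

Definition convex_body {X : normedModType R} (x : 'I_n -> X) : set 'cV[R]_n :=
  [set \col_i (f (x i) : R) | f in dual_ball X].

(* The right end-point of the interval {a . b | a in K, b in L}. *)
Definition body_dot (K L : set 'cV[R]_n) : R :=
  sup [set \sum_i a i 0 * b i 0 | a in K & b in L].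

Definition tensor_dot {X Y : normedModType R} (x : 'I_n -> X) (y : 'I_n -> Y) :
  tensor X Y := \sum_i tens (x i) (y i).

Definition reducing_matrix (c : R) {X : normedModType R} (x : 'I_n -> X)
    (A : 'M[R]_n) : Prop :=
  positive_semidefinite A /\
  forall e : 'cV[R]_n, c^-1 * eucl_norm (A *m e) <= `|vdot x e| /\
                       `|vdot x e| <= c * eucl_norm (A *m e).

End Norms.

Arguments dual_ball {R} X _.

(* Every tuple in every normed space has a reducing matrix with constant c; by
   John's theorem this holds for instance with c = sqrt n. *)
Definition reducing_constant {R : realType} (n : nat) (c : R) : Prop :=
  1 <= c /\ forall (X : normedModType R) (x : 'I_n -> X),
    exists A : 'M[R]_n, reducing_matrix c x A.

(* Main.v *)
Require Import Defs.
From HB Require Import structures.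
From mathcomp Require Import all_boot all_order all_algebra.
From mathcomp Require Import all_classical all_reals all_analysis.
From mathcomp Require Import ring lra.

(* Write A, B for the reducing matrices of x, y. If |u| <= 1/c, the functional
   x.e |-> <A u, e> on the span of x is well defined and has norm at most 1
   there, so by Hahn-Banach A u lies in the convex body of x; pairing such vectors
   with those of the body of y gives the lower bound. For the upper bound, when
   B is invertible, x (.) y is the sum over k of (x . B e_k) (x) (y . B^-1 e_k),
   whose terms have norms at most c |A B e_k| and c |B B^-1 e_k| = c. *)

Import Order.TTheory GRing.Theory Num.Theory.
Import numFieldNormedType.Exports.

Local Open Scope classical_set_scope.
Local Open Scope ring_scope.

(** * Sublinear functionals *)

Section HahnBanach.
Context {R : realType} {V : lmodType R}.
Implicit Types (p q : V -> R) (u v : V).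

(** Homogeneity is stated as an inequality for positive scalars, which is all that has to be checked
    for an infimum. Equality follows by applying it to the inverse scalar, see [sublinearZ]. *)
Definition sublinear p :=
  (forall u v, p (u + v) <= p u + p v) /\
  (forall a v, 0 < a -> p (a *: v) <= a * p v).

Lemma sublinear0 {p} : sublinear p -> p 0 = 0.
Proof.
move=> [_ pZ].
(* The factor 2 gives [0 <= p 0], the factor 1/2 gives [p 0 <= 0]. *)
have := pZ 2 0 ltac:(lra); have := pZ 2^-1 0 ltac:(lra); rewrite !scaler0; lra.
Qed.

Lemma sublinearZ {p} a v : sublinear p -> 0 <= a -> p (a *: v) = a * p v.
Proof.
move=> sp; rewrite le_eqVlt => /predU1P[<-|a0].
  by rewrite scale0r mul0r sublinear0.
have [_ pZ] := sp.
apply/eqP; rewrite eq_le pZ//= -ler_pdivlMl//.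
by rewrite -[in leLHS](scalerK (lt0r_neq0 a0) v) pZ ?invr_gt0.
Qed.

Lemma sublinear_ge {p} u v : sublinear p -> p u - p (- v) <= p (u + v).
Proof. by move=> [pD _]; rewrite lerBlDr -{1}(addrK v u) pD. Qed.

Lemma sublinear_geN {p} v : sublinear p -> - p (- v) <= p v.
Proof.
by move=> sp; have := sublinear_ge 0 v sp; rewrite sublinear0// sub0r add0r.
Qed.

(** Common pattern of the three constructions below: the infimum of a chain, the lowering along a
    ray and the extension from a subspace. Nonemptiness and lower bounds make each [inf] a true
    infimum. *)
Lemma sublinear_inf (S : V -> set R) :
  (forall v, S v !=set0) -> (forall v, has_lbound (S v)) ->
  (forall u v r s, S u r -> S v s -> exists2 t, S (u + v) t & t <= r + s) ->
  (forall a v r, 0 < a -> S v r -> exists2 t, S (a *: v) t & t <= a * r) ->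
  sublinear (fun v => inf (S v)).
Proof.
move=> S0 lbS SD SZ; split=> [u v|a v a0].
  rewrite -lerBlDr; apply: lb_le_inf => // r Sr.
  rewrite lerBlDl -lerBlDr; apply: lb_le_inf => // s Ss.
  by have [t St trs] := SD _ _ _ _ Sr Ss; rewrite lerBlDl (le_trans _ trs)// ge_inf.
rewrite -ler_pdivrMl//; apply: lb_le_inf => // r Sr; rewrite ler_pdivrMl//.
by have [t St tr] := SZ _ _ _ a0 Sr; rewrite (le_trans _ tr)// ge_inf.
Qed.

(** Zorn's lemma among the sublinear functionals below [p]: the pointwise infimum of a chain is
    again sublinear. *)
Lemma minimal_sublinear p : sublinear p ->
  exists q, [/\ sublinear q, forall v, q v <= p v &
    forall q', sublinear q' -> (forall v, q' v <= q v) -> forall v, q' v = q v].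
Proof.
move=> sp.
pose P q := sublinear q /\ forall v, q v <= p v.
pose T := {q | P q}.
pose t0 : T := exist P p (conj sp (fun v => lexx (p v))).
(* The order is reversed, so that maximal elements are minimal functionals. *)
pose le (s t : T) := `[< forall v, sval t v <= sval s v >].
have [||A totA|t maxt] := @ZL_preorder T t0 le.
- by move=> t; apply/asboolP.
- move=> r s t /asboolP rs /asboolP st; apply/asboolP => v.
  exact: le_trans (st v) (rs v).
- have [[t1 At1]|A0] := pselect (A !=set0); last first.
    by exists t0 => s As; case: A0; exists s.
  pose S v := [set sval t v | t in A].
  have lbS v : has_lbound (S v).
    exists (- p (- v)) => _ [t At <-].
    have [st tp] := svalP t.
    by rewrite (le_trans _ (sublinear_geN v st))// lerN2.
  have sS : sublinear (fun v => inf (S v)).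
    apply: sublinear_inf => //.
    - by move=> v; exists (sval t1 v), t1.
    - move=> u v _ _ [s As <-] [t At <-].
      (* Two members of a chain are comparable, and the smaller one serves at [u], [v] and [u + v]
         alike. *)
      have [/asboolP st|/asboolP ts] := totA _ _ As At.
        exists (sval t (u + v)); first by exists t.
        by rewrite (le_trans ((svalP t).1.1 u v))// lerD2r.
      exists (sval s (u + v)); first by exists s.
      by rewrite (le_trans ((svalP s).1.1 u v))// lerD2l.
    - move=> a v _ a0 [t At <-]; exists (sval t (a *: v)); first by exists t.
      exact: (svalP t).1.2.
  have Sp v : inf (S v) <= p v.
    apply: le_trans ((svalP t1).2 v).
    by apply: ge_inf => //; exists t1.
  exists (exist P _ (conj sS Sp)) => t At; apply/asboolP => v /=.
  by apply: ge_inf => //; exists t.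
exists (sval t); split; [exact: (svalP t).1|exact: (svalP t).2|].
move=> q sq qt v.
have qp u : q u <= p u by rewrite (le_trans (qt u))// (svalP t).2.
apply/eqP; rewrite eq_le qt/=; move: v; apply/asboolP.
by apply: (maxt (exist P q (conj sq qp))); apply/asboolP.
Qed.

(* Lowering q along the ray spanned by y, v |-> inf_(t >= 0) (q (v + t y) - t q y),
   does not change a minimal q; taking t = 1 gives superadditivity. *)
Lemma minimal_sublinear_linear q : sublinear q ->
  (forall q', sublinear q' -> (forall v, q' v <= q v) -> forall v, q' v = q v) ->
  linear (q : V -> R^o).
Proof.
move=> sq minq.
have qD u y : q (u + y) = q u + q y.
  apply/eqP; rewrite eq_le sq.1/= -lerBrDr.
  pose S v := [set q (v + t *: y) - t * q y | t in [set t | 0 <= t]].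
  have lbS v : has_lbound (S v).
    exists (- q (- v)) => _ [t /= t0 <-].
    have := sublinear_ge (t *: y) v sq.
    by rewrite (sublinearZ _ _ sq t0) (addrC _ v) lerBrDl.
  have S0 v : S v (q v) by exists 0 => //=; rewrite scale0r addr0 mul0r subr0.
  (* By minimality [q u] equals the infimum of [S u]. *)
  rewrite -(minq (fun v => inf (S v))).
  - apply: ge_inf => //; exists 1; first by rewrite /= ler01.
    by rewrite scale1r mul1r.
  - apply: sublinear_inf => //.
    + by move=> v; exists (q v).
    + move=> v w _ _ [s /= s0 <-] [t /= t0 <-].
      exists (q (v + w + (s + t) *: y) - (s + t) * q y).
        by exists (s + t) => //=; rewrite addr_ge0.
      rewrite scalerDl addrACA mulrDl opprD [leRHS]addrACA lerD2r.
      exact: sq.1.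
    + move=> a v _ a0 [t /= t0 <-].
      exists (q (a *: v + (a * t) *: y) - a * t * q y).
        by exists (a * t) => //=; rewrite mulr_ge0// ltW.
      by rewrite -scalerA -scalerDr (sublinearZ _ _ sq (ltW a0)) mulrBr mulrA.
  - by move=> v; exact: ge_inf.
have qN v : q (- v) = - q v.
  by apply/eqP; rewrite -subr_eq0 opprK -qD addNr sublinear0.
move=> a u v; rewrite qD; congr (_ + _).
have [a0|/ltW a0] := leP 0 a; first exact: sublinearZ.
by rewrite -[a in LHS]opprK scaleNr qN sublinearZ ?oppr_ge0// mulNr opprK.
Qed.

(** The functional [v |-> inf_w (p (v - T w) + phi w)] is sublinear, lies below [p], and lies below
    [phi] on the image of [T]. A minimal sublinear functional under it is linear and is the
    extension. The bound on [phi] forces it to vanish on the kernel of [T], so [T] may fail to be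
    injective. *)
Lemma hahn_banach (W : lmodType R) (T : {linear W -> V}) (phi : {linear W -> R^o}) p :
  sublinear p -> (forall w, phi w <= p (T w)) ->
  exists f : {linear V -> R^o},
    (forall w, f (T w) = phi w) /\ forall v, f v <= p v.
Proof.
move=> sp phip.
pose S v := [set p (v - T w) + phi w | w in [set: W]].
have lbS v : has_lbound (S v).
  exists (- p (- v)) => _ [w _ <-].
  (* Since [- phi w <= p (- T w)], the lower bound [- p (- v)] does not depend on [w]. *)
  have := phip (- w); have := sublinear_ge (- T w) v sp.
  by rewrite !raddfN (addrC _ v) /=; lra.
have Sp v : S v (p v) by exists 0 => //; rewrite !raddf0 !addr0.
have sS : sublinear (fun v => inf (S v)).
  apply: sublinear_inf => //.
  - by move=> v; exists (p v).
  - move=> u v _ _ [w1 _ <-] [w2 _ <-].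
    exists (p (u + v - T (w1 + w2)) + phi (w1 + w2)); first by exists (w1 + w2).
    rewrite (linearD T) (linearD phi) opprD addrACA [leRHS]addrACA lerD2r.
    exact: sp.1.
  - move=> a v _ a0 [w _ <-].
    exists (p (a *: v - T (a *: w)) + phi (a *: w)); first by exists (a *: w).
    by rewrite (linearZ_LR T) (linearZ_LR phi) -scalerBr (sublinearZ _ _ sp (ltW a0)) mulrDr.
have [q [sq qS minq]] := minimal_sublinear _ sS.
have lq := minimal_sublinear_linear _ sq minq.
pose f : {linear V -> R^o} := HB.pack (q : V -> R^o) (GRing.isLinear.Build _ _ _ _ _ lq).
have fphi w : f (T w) <= phi w.
  apply: le_trans (qS _) _; apply: ge_inf => //; exists w => //.
  by rewrite subrr sublinear0// add0r.
exists f; split=> [w|v].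
  (* A linear functional below a linear functional equals it: compare at [- w]. *)
  apply/eqP; rewrite eq_le fphi/=.
  by have := fphi (- w); rewrite (linearN T) (linearN f) (linearN phi) lerN2.
by apply: le_trans (qS _) _; apply: ge_inf.
Qed.

End HahnBanach.

(** * Euclidean norm *)

Section Euclidean.
Context {R : realType} {n : nat}.
Implicit Types (u v e : 'cV[R]_n) (A B M : 'M[R]_n).

Definition dot u v : R := \sum_i u i 0 * v i 0.

Lemma dotE u v : dot u v = (u^T *m v) 0 0.
Proof. by rewrite mxE; apply: eq_bigr => i _; rewrite mxE. Qed.

Lemma dotC u v : dot u v = dot v u.
Proof. by apply: eq_bigr => i _; rewrite mulrC. Qed.

Lemma dot_linear u : linear (dot u : _ -> R^o).
Proof. by move=> a v w; rewrite !dotE linearP !mxE. Qed.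

HB.instance Definition _ u :=
  GRing.isLinear.Build R _ R^o _ (dot u) (dot_linear u).

Lemma dot_mull M u v : dot (M *m u) v = dot u (M^T *m v).
Proof. by rewrite !dotE trmx_mul mulmxA. Qed.

Lemma dot_delta u i : dot u (delta_mx i 0) = u i 0.
Proof.
rewrite /dot (bigD1 i)//= big1 => [|k /negPf ki]; rewrite mxE ?eqxx ?ki ?mulr0//.
by rewrite mulr1 addr0.
Qed.

Lemma eucl_norm_ge0 u : 0 <= eucl_norm u.
Proof. exact: sqrtr_ge0. Qed.

Lemma dotvv u : dot u u = eucl_norm u ^+ 2.
Proof.
rewrite sqr_sqrtr; last by apply: sumr_ge0 => i _; rewrite sqr_ge0.
by apply: eq_bigr => i _; rewrite expr2.
Qed.

Lemma eucl_norm_eq0 u : eucl_norm u = 0 -> u = 0.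
Proof.
move=> u0; have /eqP := dotvv u; rewrite u0 expr0n/= psumr_eq0 => [|i _]; last first.
  by rewrite -expr2 sqr_ge0.
move=> /allP h; apply/matrixP => i j; rewrite ord1 mxE.
by have := h i (mem_index_enum _); rewrite -expr2 sqrf_eq0 => /eqP.
Qed.

Lemma eucl_norm0 : eucl_norm (0 : 'cV[R]_n) = 0.
Proof. by rewrite /eucl_norm big1 ?sqrtr0// => i _; rewrite mxE expr0n. Qed.

Lemma eucl_normZ a u : eucl_norm (a *: u) = `|a| * eucl_norm u.
Proof.
rewrite -sqrtr_sqr -sqrtrM ?sqr_ge0// mulr_sumr; congr Num.sqrt.
by apply: eq_bigr => i _; rewrite mxE exprMn.
Qed.

Lemma eucl_norm_delta i : eucl_norm (delta_mx i 0 : 'cV[R]_n) = 1.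
Proof.
rewrite /eucl_norm (bigD1 i)//= big1 => [|j /negPf ji].
  by rewrite mxE !eqxx expr1n addr0 sqrtr1.
by rewrite mxE ji expr0n.
Qed.

Lemma cauchy_schwarz u v : dot u v <= eucl_norm u * eucl_norm v.
Proof.
have [u0|u0] := eqVneq (eucl_norm u) 0.
  by rewrite (eucl_norm_eq0 _ u0) dotC linear0 eucl_norm0 mul0r.
have [v0|v0] := eqVneq (eucl_norm v) 0.
  by rewrite (eucl_norm_eq0 _ v0) linear0 eucl_norm0 mulr0.
set a := eucl_norm u; set b := eucl_norm v.
have ab0 : 0 < a * b by rewrite mulr_gt0// lt0r ?u0 ?v0 eucl_norm_ge0.
(* Expanding this square gives [2ab (ab - <u, v>)], where [ab > 0]. *)
have : 0 <= dot (b *: u - a *: v) (b *: u - a *: v) by rewrite dotvv sqr_ge0.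
have -> : dot (b *: u - a *: v) (b *: u - a *: v) =
    2 * (a * b) * (a * b - dot u v).
  transitivity (b ^+ 2 * dot u u - 2 * a * b * dot u v + a ^+ 2 * dot v v).
    rewrite /dot !mulr_sumr -sumrB -big_split/=.
    by apply: eq_bigr => i _; rewrite !mxE; ring.
  by rewrite !dotvv -/a -/b; ring.
have ab2 : 0 < 2 * (a * b) by rewrite mulr_gt0.
by rewrite (pmulr_rge0 _ ab2) subr_ge0.
Qed.

Lemma eucl_normD u v : eucl_norm (u + v) <= eucl_norm u + eucl_norm v.
Proof.
rewrite -ler_sqr ?nnegrE ?addr_ge0 ?eucl_norm_ge0// -dotvv.
have -> : dot (u + v) (u + v) = dot u u + 2 * dot u v + dot v v.
  rewrite /dot mulr_sumr -!big_split/=.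
  by apply: eq_bigr => i _; rewrite !mxE; ring.
by rewrite !dotvv; have := cauchy_schwarz u v; lra.
Qed.

(** Cauchy-Schwarz in each row bounds [M e] by the Frobenius norm of [M]. Without boundedness the
    [sup] in [op_norm] would take its default value. *)
Lemma op_norm_has_ubound M :
  has_ubound [set eucl_norm (M *m e) | e in [set e | eucl_norm e <= 1]].
Proof.
pose r i := eucl_norm (row i M)^T.
exists (Num.sqrt (\sum_i r i ^+ 2)) => _ [e /= e1 <-].
apply/ler_wsqrtr/ler_sum => i _.
have rowE : (M *m e) i 0 = dot (row i M)^T e.
  by rewrite mxE; apply: eq_bigr => j _; rewrite !mxE.
have le_r v : eucl_norm v <= 1 -> dot (row i M)^T v <= r i.
  move=> v1; apply: le_trans (cauchy_schwarz _ _) _.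
  by rewrite ler_piMr ?eucl_norm_ge0.
rewrite rowE -ler_sqrt ?sqr_ge0// !sqrtr_sqr (ger0_norm (eucl_norm_ge0 _)).
rewrite ler_norml le_r// andbT lerNl -linearN le_r//.
by rewrite -scaleN1r eucl_normZ normrN1 mul1r.
Qed.

Lemma op_norm_ub M e : eucl_norm e <= 1 -> eucl_norm (M *m e) <= op_norm M.
Proof. by move=> e1; apply: (ub_le_sup (op_norm_has_ubound M)); exists e. Qed.

Lemma op_norm_ge0 M : 0 <= op_norm M.
Proof.
have := op_norm_ub M 0; rewrite mulmx0 eucl_norm0; apply; exact: ler01.
Qed.

Lemma ge_op_norm M r :
  (forall e, eucl_norm e <= 1 -> eucl_norm (M *m e) <= r) -> op_norm M <= r.
Proof.
move=> Mr; apply: ge_sup => [|_ [e e1 <-]]; last exact: Mr.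
by exists (eucl_norm (M *m 0)), 0 => //=; rewrite eucl_norm0.
Qed.

(** The square on the right exceeds the one on the left by [2t <e, A e> + t^2 |e|^2], which is
    nonnegative. *)
Lemma psd_shift_norm A t e : positive_semidefinite A -> 0 <= t ->
  eucl_norm (A *m e) <= eucl_norm ((A + t%:M) *m e).
Proof.
move=> [_ pA] t0; rewrite -ler_sqr ?nnegrE ?eucl_norm_ge0// -!dotvv.
rewrite mulmxDl mul_scalar_mx.
have -> : dot (A *m e + t *: e) (A *m e + t *: e) =
    dot (A *m e) (A *m e) + 2 * t * dot e (A *m e) + t ^+ 2 * dot e e.
  move: (A *m e) => a; rewrite /dot !mulr_sumr -!big_split/=.
  by apply: eq_bigr => i _; rewrite !mxE; ring.
rewrite -addrA lerDl addr_ge0// mulr_ge0 ?mulr_ge0 ?sqr_ge0//.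
  by rewrite dotE mulmxA.
by rewrite dotvv sqr_ge0.
Qed.

(** Pairing a kernel vector [v] with its image gives [<v, A v> + t |v|^2 = 0], hence [v = 0]. The
    row kernel is transposed using the symmetry of [A]. *)
Lemma psd_shift_unit A t : positive_semidefinite A -> 0 < t ->
  A + t%:M \in unitmx.
Proof.
move=> [AT pA] t0; rewrite -row_free_unit; apply: inj_row_free => v.
move=> /(congr1 trmx); rewrite trmx_mul trmx0 linearD/= tr_scalar_mx AT.
rewrite mulmxDl mul_scalar_mx => Av0.
have : dot v^T (A *m v^T + t *: v^T) = 0 by rewrite Av0 linear0.
rewrite linearD linearZ/= dotvv dotE mulmxA => v0.
have v2 : t * eucl_norm v^T ^+ 2 <= 0 by have := pA v^T; rewrite /GRing.scale/= in v0; lra.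
have /eqP : eucl_norm v^T ^+ 2 = 0.
  by apply/eqP; rewrite eq_le sqr_ge0 andbT -(pmulr_rle0 _ t0).
rewrite sqrf_eq0 => /eqP /eucl_norm_eq0 /(congr1 trmx).
by rewrite trmxK trmx0.
Qed.

End Euclidean.

(** * The dual unit ball *)

Section Duality.
Context {R : realType}.
Implicit Types X Y : normedModType R.

(** This one-sided form is what Hahn-Banach yields; the bound on absolute values follows by passing
    to [- x]. Continuity makes the supremum in [dual_norm] finite, and conversely the bound implies
    continuity. *)
Lemma dual_ballP X (f : {linear X -> R^o}) :
  dual_ball X f <-> forall x, f x <= `|x|.
Proof.
split=> [[fc f1] x|fle].
  have /bounded_funP/(_ 1)[M fM] := continuous_linear_bounded 0 (fc 0).
  have ub : has_ubound [set `|f x| | x in [set x : X | `|x| <= 1]].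
    by exists M => _ [y /= y1 <-]; exact: fM.
  apply: le_trans (ler_norm _) _.
  have [->|x0] := eqVneq x 0; first by rewrite linear0 !normr0.
  have nx : 0 < `|x| by rewrite normr_gt0.
  have : `|f (`|x|^-1 *: x)| <= 1.
    apply: le_trans f1; apply: ub_le_sup => //.
    exists (`|x|^-1 *: x) => //=.
    by rewrite normrZ gtr0_norm ?invr_gt0// mulVf ?gt_eqF.
  by rewrite linearZ normrZ gtr0_norm ?invr_gt0// ler_pdivrMl// mulr1.
have nfle x : `|f x| <= `|x|.
  by rewrite ler_norml fle andbT lerNl -linearN -(normrN x) fle.
split.
  apply: bounded_linear_continuous; apply/bounded_funP => r; exists r => x.
  exact: le_trans.
apply: ge_sup => [|_ [x /= x1 <-]]; last exact: le_trans (nfle x) x1.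
by exists `|f 0|, 0 => //=; rewrite normr0.
Qed.

Lemma dual_ball_norm X (f : {linear X -> R^o}) x :
  dual_ball X f -> `|f x| <= `|x|.
Proof.
move=> /dual_ballP fle.
by rewrite ler_norml fle andbT lerNl -linearN -(normrN x) fle.
Qed.

Lemma dual_ball0 X : dual_ball X (\0 : {linear X -> R^o}).
Proof. by apply/dual_ballP => x; exact: normr_ge0. Qed.

End Duality.

(** * Convex bodies and tensor norms *)

Section Vdot.
Context {R : realType} {n : nat}.
Implicit Types X Y : normedModType R.

Lemma vdot_linear X (x : 'I_n -> X) : linear (vdot x).
Proof.
move=> a e e'; rewrite /vdot scaler_sumr -big_split/=.
by apply: eq_bigr => i _; rewrite !mxE scalerDl scalerA.
Qed.

HB.instance Definition _ X (x : 'I_n -> X) :=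
  GRing.isLinear.Build R _ X _ (vdot x) (vdot_linear X x).

Lemma vdot_delta X (x : 'I_n -> X) i : vdot x (delta_mx i 0) = x i.
Proof.
rewrite /vdot (bigD1 i)//= [X in _ + X]big1 => [|j /negPf ji].
  by rewrite mxE !eqxx scale1r addr0.
by rewrite mxE ji scale0r.
Qed.

Lemma convex_body_reducing (c : R) X (x : 'I_n -> X) (A : 'M[R]_n) u :
  reducing_matrix c x A -> eucl_norm u <= c^-1 -> convex_body x (A *m u).
Proof.
move=> [[AT _] rA] uc.
have snorm : sublinear (fun v : X => `|v|).
  split=> [v w|a v a0]; first exact: ler_normD.
  by rewrite normrZ gtr0_norm.
have [|f [fx fle]] := hahn_banach _ (vdot x) (dot (A *m u)) _ snorm.
  (* [<A u, e> = <u, A e> <= |u| |A e| <= c^-1 |A e| <= |x . e|]. *)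
  move=> e; rewrite /= dot_mull AT; apply: le_trans (cauchy_schwarz _ _) _.
  apply: le_trans (rA e).1.
  by rewrite ler_wpM2r ?eucl_norm_ge0.
exists f; first exact/dual_ballP.
by apply/matrixP => i j; rewrite ord1 mxE -vdot_delta fx /= dot_delta.
Qed.

End Vdot.

Section TensorNorms.
Context {R : realType} {X Y : normedModType R}.

Lemma tens_sum (I : finType) (u : I -> X) (v : I -> Y) :
  \sum_i tens (u i) (v i) =
  \sum_(p <- [seq (u i, v i) | i <- index_enum I]) tens p.1 p.2.
Proof. by rewrite big_map. Qed.

Lemma tensor_lift_prod (f : {linear X -> R^o}) (g : {linear Y -> R^o}) s :
  tensor_lift (fun u v => f u * g v : R^o) (\sum_(p <- s) tens p.1 p.2) =
  \sum_(p <- s) f p.1 * g p.2.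
Proof.
apply: tensor_lift_sum => [v a u u'|u a v v'].
  by rewrite linearP mulrDl /GRing.scale/= mulrA.
by rewrite linearP mulrDr /GRing.scale/= mulrCA.
Qed.

Lemma projective_norm_le (I : finType) (u : I -> X) (v : I -> Y) :
  projective_norm (\sum_i tens (u i) (v i)) <= \sum_i `|u i| * `|v i|.
Proof.
apply: ge_inf.
  exists 0 => _ [s _ <-]; apply: sumr_ge0 => p _; exact: mulr_ge0.
exists [seq (u i, v i) | i <- index_enum I]; first exact: tens_sum.
by rewrite big_map.
Qed.

Lemma injective_le_projective (w : tensor X Y) :
  injective_norm w <= projective_norm w.
Proof.
apply: lb_le_inf => [|_ [s /= -> <-]].
  by have [s ws] := tensorP w; exists (\sum_(p <- s) `|p.1| * `|p.2|), s.
apply: ge_sup => [|_ [f Df [g Dg <-]]].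
  (* The zero functionals show that the supremum is over a nonempty set. *)
  exists (tensor_lift (fun u v => (\0 : {linear X -> R^o}) u *
      (\0 : {linear Y -> R^o}) v : R^o) (\sum_(p <- s) tens p.1 p.2)).
  by exists \0; [exact: dual_ball0|exists \0 => //; exact: dual_ball0].
rewrite tensor_lift_prod; apply: ler_sum => p _.
apply: le_trans (ler_norm _) _; rewrite normrM ler_pM//; exact: dual_ball_norm.
Qed.

Context {n : nat} (x : 'I_n -> X) (y : 'I_n -> Y).

(** Both suprema run over the same set of reals: the lift of [f (x) g] at [x (.) y] is the dot
    product of the corresponding points of the bodies. *)
Lemma body_dot_injective :
  body_dot (convex_body x) (convex_body y) = injective_norm (tensor_dot x y).
Proof.
have liftE (f : {linear X -> R^o}) (g : {linear Y -> R^o}) :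
    tensor_lift (fun u v => f u * g v : R^o) (tensor_dot x y) =
    \sum_i f (x i) * g (y i).
  by rewrite /tensor_dot tens_sum tensor_lift_prod big_map.
congr sup; apply/seteqP; split=> [_ [_ [f Df <-] [_ [g Dg <-] <-]]|_ [f Df [g Dg <-]]].
  exists f => //; exists g => //; rewrite liftE.
  by apply: eq_bigr => i _; rewrite !mxE.
rewrite liftE; exists (\col_i (f (x i) : R)); first by exists f.
exists (\col_i (g (y i) : R)); first by exists g.
by apply: eq_bigr => i _; rewrite !mxE.
Qed.

Lemma body_dot_ub a b : convex_body x a -> convex_body y b ->
  dot a b <= body_dot (convex_body x) (convex_body y).
Proof.
move=> Ka Lb; apply: ub_le_sup; last by exists a => //; exists b.
exists (\sum_i `|x i| * `|y i|) => _ [_ [f Df <-] [_ [g Dg <-] <-]].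
apply: ler_sum => i _; rewrite !mxE.
apply: le_trans (ler_norm _) _; rewrite normrM ler_pM//; exact: dual_ball_norm.
Qed.

(** Invariance under contragredient changes of basis: after bilinear expansion the coefficient of
    [x_i (x) y_j] is the [(i, j)] entry of [U V^T]. *)
Lemma tensor_dot_basis (U V : 'M[R]_n) : U *m V^T = 1%:M ->
  tensor_dot x y = \sum_k tens (vdot x (col k U)) (vdot y (col k V)).
Proof.
move=> UV.
have t0l v : tens (0 : X) (v : Y) = 0 by rewrite -(scale0r 0) tensZl scale0r.
have t0r (u : X) : tens u (0 : Y) = 0 by rewrite -(scale0r 0) tensZr scale0r.
have tvdot k : tens (vdot x (col k U)) (vdot y (col k V)) =
    \sum_i \sum_j (U i k * V j k) *: tens (x i) (y j).
  rewrite /vdot (big_morph (fun u => tens u _) (fun u u' => tensDl u u' _) (t0l _)).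
  apply: eq_bigr => i _.
  rewrite (big_morph (tens _) (fun v v' => tensDr _ v v') (t0r _)).
  by apply: eq_bigr => j _; rewrite !mxE tensZl tensZr scalerA.
rewrite (eq_bigr _ (fun k _ => tvdot k)) exchange_big; apply: eq_bigr => i _.
have UVij j : \sum_k U i k * V j k = (i == j)%:R.
  have := congr1 (fun M : 'M[R]_n => M i j) UV; rewrite !mxE => <-.
  by apply: eq_bigr => k _; rewrite mxE.
rewrite exchange_big/= (bigD1 i)//= [X in _ + X]big1 => [|j /negPf ji].
  by rewrite addr0 -scaler_suml UVij eqxx scale1r.
by rewrite -scaler_suml UVij eq_sym ji scale0r.
Qed.

(** * Comparison with the operator norm of the product of reducing matrices *)

Variables (c : R) (A B : 'M[R]_n).
Hypotheses (c0 : 0 < c) (rA : reducing_matrix c x A) (rB : reducing_matrix c y B).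

Lemma op_norm_le_body_dot :
  (c ^+ 2)^-1 * op_norm (A *m B) <= body_dot (convex_body x) (convex_body y).
Proof.
have c2 : 0 < c ^+ 2 by rewrite exprn_gt0.
rewrite mulrC ler_pdivrMr// mulrC; apply: ge_op_norm => e e1.
have ci : 0 < c^-1 by rewrite invr_gt0.
set z := A *m B *m e; set r := eucl_norm z.
(* If [z = 0] it cannot be normalized, but both bodies contain 0, so [body_dot] is nonnegative. *)
have [r0|r0] := eqVneq r 0.
  rewrite r0 mulr_ge0 ?sqr_ge0//.
  have cb0 (Z : normedModType R) (w : 'I_n -> Z) C : reducing_matrix c w C ->
      convex_body w 0.
    move=> rC; rewrite -(mulmx0 _ C); apply: (convex_body_reducing _ _ _ _ _ rC).
    by rewrite eucl_norm0 ltW.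
  by have := body_dot_ub _ _ (cb0 _ _ _ rA) (cb0 _ _ _ rB); rewrite linear0.
have rp : 0 < r by rewrite lt0r r0 eucl_norm_ge0.
(* With [u = z / (c |z|)] and [v = e / c], symmetry of [A] gives
   [<A u, B v> = <u, A B e> / c = |z| / c^2]. *)
have uA : convex_body x (A *m ((c^-1 * r^-1) *: z)).
  apply: (convex_body_reducing _ _ _ _ _ rA).
  by rewrite eucl_normZ gtr0_norm ?mulr_gt0 ?invr_gt0// -mulrA mulVf ?mulr1.
have vB : convex_body y (B *m (c^-1 *: e)).
  apply: (convex_body_reducing _ _ _ _ _ rB).
  by rewrite eucl_normZ gtr0_norm// (ler_piMr (ltW ci)).
have := body_dot_ub _ _ uA vB.
rewrite dot_mull rA.1.1 mulmxA -scalemxAr linearZ/= dotC linearZ/= -/z dotvv -/r.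
rewrite /GRing.scale/= => h.
rewrite mulrC -ler_pdivrMr//; apply: le_trans h.
by rewrite le_eqVlt; apply/orP; left; apply/eqP; field; rewrite r0 gt_eqF.
Qed.

(* As B may be singular, it is replaced by the invertible matrix B + t, t > 0. *)
Lemma projective_norm_le_op_norm :
  projective_norm (tensor_dot x y) <= n%:R * c ^+ 2 * op_norm (A *m B).
Proof.
have [pB rB'] := rB.
have key t : 0 < t -> projective_norm (tensor_dot x y) <=
    n%:R * c ^+ 2 * (op_norm (A *m B) + t * op_norm A).
  move=> t0; pose U := B + t%:M; pose V := (invmx U)^T.
  have uU : U \in unitmx by exact: psd_shift_unit.
  have UT : U^T = U by rewrite /U linearD/= tr_scalar_mx pB.1.
  have UV : U *m V^T = 1%:M by rewrite trmxK mulmxV.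
  have UV' : U *m V = 1%:M by rewrite /V trmx_inv UT mulmxV.
  rewrite (tensor_dot_basis _ _ UV); apply: le_trans (projective_norm_le _ _ _) _.
  (* The factor [n] becomes a sum of [n] equal terms, to be compared term by term. *)
  rewrite -mulrA mulr_natl -[n in _ *+ n]card_ord -sumr_const.
  apply: ler_sum => k _; rewrite !colE.
  have e1 : eucl_norm (delta_mx k 0 : 'cV[R]_n) <= 1 by rewrite eucl_norm_delta.
  rewrite [leRHS](_ : _ = (c * (op_norm (A *m B) + t * op_norm A)) * (c * 1));
    last by ring.
  apply: ler_pM => //.
    apply: le_trans (rA.2 _).2 _; rewrite ler_pM2l//.
    rewrite mulmxA mulmxDr mulmxDl mul_mx_scalar -scalemxAl.
    apply: le_trans (eucl_normD _ _) _; rewrite eucl_normZ gtr0_norm//.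
    by rewrite lerD ?ler_pM2l// op_norm_ub.
  apply: le_trans (rB' _).2 _; rewrite ler_pM2l//.
  (* [|B V e_k| <= |(B + t) V e_k| = |e_k| = 1], as [V] is the inverse of [B + t]. *)
  apply: le_trans (psd_shift_norm _ _ _ pB (ltW t0)) _.
  by rewrite mulmxA UV' mul1mx.
(* Let [t] tend to 0: for [t = d / (K + 1)] the error [K t] is at most [d]. The added 1 covers
   [K = 0]. *)
apply/ler_addgt0Pr => d d0.
pose K := n%:R * c ^+ 2 * op_norm A.
have K0 : 0 <= K by rewrite !mulr_ge0 ?sqr_ge0 ?op_norm_ge0// ltW.
have K1 : 0 < K + 1 by lra.
apply: le_trans (key (d / (K + 1)) _) _; first exact: divr_gt0.
rewrite mulrDr lerD2l [leLHS](_ : _ = d * (K / (K + 1))); last first.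
  by rewrite /K; ring.
by rewrite ger_pMr// ler_pdivrMr// mul1r; lra.
Qed.

End TensorNorms.

Theorem proposition3p2 (R : realType) (n : nat) (c : R) :
  (1 <= n)%N -> reducing_constant n c ->
  exists C : R, 1 <= C /\
    forall (X Y : normedModType R) (x : 'I_n -> X) (y : 'I_n -> Y)
           (A B : 'M[R]_n),
      reducing_matrix c x A -> reducing_matrix c y B ->
      [/\ C^-1 * op_norm (A *m B) <= body_dot (convex_body x) (convex_body y),
          body_dot (convex_body x) (convex_body y)
            = injective_norm (tensor_dot x y),
          injective_norm (tensor_dot x y)
            <= projective_norm (tensor_dot x y)
        & projective_norm (tensor_dot x y) <= C * op_norm (A *m B)].
Proof.
move=> n1 [c1 _]; have c0 : 0 < c by exact: lt_le_trans c1.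
have c2 : 1 <= c ^+ 2 by rewrite exprn_ege1.
have c2C : c ^+ 2 <= n%:R * c ^+ 2 by rewrite ler_peMl ?sqr_ge0// ler1n.
(* The upper bound dictates this constant. The lower bound holds with [c^2], which is at most
   [n c^2] because [n >= 1]. *)
exists (n%:R * c ^+ 2); split=> [|X Y x y A B rA rB]; first exact: le_trans c2C.
split; [|exact: body_dot_injective|exact: injective_le_projective|].
  apply: le_trans (op_norm_le_body_dot _ _ c A B c0 rA rB).
  have c2_gt0 : 0 < c ^+ 2 by exact: lt_le_trans c2.
  by rewrite ler_wpM2r ?op_norm_ge0// lef_pV2 ?posrE// (lt_le_trans c2_gt0).
exact: projective_norm_le_op_norm.
Qed.
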